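(* Let $q\ge1$, $m=q(q+1)/2$, and let $L:S^q\to\mathbb{R}^m$ be an invertible linear map with $L(M_1)^TL(M_2)=\mathrm{Tr}(M_1M_2)$ for all $M_1,M_2\in S^q$. Identify $S^q$ with $\mathbb{R}^{m}$ via $L$ and let $K$ be the positive semidefinite cone $S^q_+$, i.e. $K=L(S^q_+)\subseteq\mathbb{R}^m$. Let $\overline{A}=[\overline a_1\mid\dots\mid\overline a_m]^T\in\mathbb{R}^{m\times n}$, $\overline b\in\mathbb{R}^m$ be such that $\{x\in\mathbb{R}^n:\overline Ax+\overline b\in -K\}\neq\emptyset$. Then the radius of robust feasibility satisfies $$\frac{2}{q(q+1)}\sqrt{f^\ast_{SDP}}\le\rho(\overline A,\overline b)\le\sqrt q\,\sqrt{f^\ast_{SDP}},$$ where $f^\ast_{SDP}$ is the optimal value of the semidefinite program $$\inf_{\substack{(z,s,t,\lambda)\in\mathbb{R}^n\times\mathbb{R}\times\mathbb{R}\times\mathbb{R}^m\\ \Lambda\in S^q}}\left\{t:\ \begin{bmatrix} tI_n & 0_n & z \\ 0_n^T & t & s \\ z^T & s & 1 \end{bmatrix}\succeq0,\ z=\overline A^T\lambda,\ s\ge-\overline b^T\lambda,\ \lambda=L(\Lambda),\ \Lambda\in S^q_+,\ \mathrm{Tr}(\Lambda)=1\right\}.$$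
   Context: $S^q$ is the space of real symmetric $(q\times q)$ matrices, $S^q_+$ the cone of positive semidefinite ones; $M\succeq 0$ means positive semidefinite. $\mathbb{B}_{n+1}$ is the closed Euclidean unit ball of $\mathbb{R}^{n+1}$. For $r\in\mathbb{R}^m_+$, the robust feasible set is $$F_r(\overline A,\overline b)=\{x\in\mathbb{R}^n: (a_1^Tx+b_1,\dots,a_m^Tx+b_m)^T\in -K\ \ \forall (a_i,b_i)\in(\overline a_i,\overline b_i)+r_i\mathbb{B}_{n+1},\ i=1,\dots,m\}.$$ The admissible set is $C(\overline A,\overline b)=\{r\in\mathbb{R}^m_+:F_r(\overline A,\overline b)\ne\emptyset\}$, and the radius of robust feasibility is $\rho(\overline A,\overline b)=\sup\{\alpha\in\mathbb{R}_+:\alpha 1_m\in C(\overline A,\overline b)\}$, with $1_m$ the all-ones vector. *)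

(* Defs.v *)
From HB Require Import structures.
From mathcomp Require Import all_boot all_order all_algebra.
From mathcomp Require Import boolp classical_sets reals ereal.

Set Implicit Arguments.
Unset Strict Implicit.
Unset Printing Implicit Defensive.

Import Order.TTheory GRing.Theory Num.Theory.

Local Open Scope classical_set_scope.
Local Open Scope ring_scope.

Section SymmetricMatrices.
Variables (R : fieldType) (q : nat).

Definition symmx_pred : {pred 'M[R]_q} := [pred M : 'M[R]_q | M \is symmetricmx].

Lemma symmx_predE (M : 'M[R]_q) : (M \in symmx_pred) = (M^T == M).
Proof. by rewrite inE qualifE /= expr0 scale1r map_mx_id // eq_sym. Qed.

Fact symmx_submod_closed : submod_closed symmx_pred.
Proof.
split=> [|a M N]; rewrite !symmx_predE; first by rewrite trmx0.
by move=> /eqP MT /eqP NT; rewrite linearP /= MT NT.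
Qed.

HB.instance Definition _ :=
  GRing.isSubmodClosed.Build R 'M[R]_q symmx_pred symmx_submod_closed.

Record symmx := SymMx {
  mx_of_symmx :> 'M[R]_q;
  _ : mx_of_symmx \in symmx_pred }.

HB.instance Definition _ := [isSub for mx_of_symmx].
HB.instance Definition _ := [Choice of symmx by <:].
HB.instance Definition _ := [SubChoice_isSubZmodule of symmx by <:].
HB.instance Definition _ := [SubZmodule_isSubLmodule of symmx by <:].

End SymmetricMatrices.

Section RobustFeasibility.
Variable R : realType.

Definition psdmx k (M : 'M[R]_k) : Prop :=
  M \is symmetricmx /\ forall v : 'cV[R]_k, 0 <= (v^T *m M *m v) 0 0.

(* Euclidean unit ball; the norm the library puts on matrices is the sup norm *)
Definition euclidean_unit_ball k : set 'rV[R]_k :=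
  [set u | Num.sqrt (\sum_i u 0 i ^+ 2) <= 1].

Section Radius.
Variables (m n : nat) (K : set 'cV[R]_m) (A0 : 'M[R]_(m, n)) (b0 : 'cV[R]_m).

(* row i of (A, b) is the vector (a_i, b_i) of R^(n+1) *)
Definition uncertainty_set (r : 'cV[R]_m) : set ('M[R]_(m, n) * 'cV[R]_m) :=
  [set Ab | forall i : 'I_m, exists2 u, euclidean_unit_ball u &
    row i (row_mx Ab.1 Ab.2) = row i (row_mx A0 b0) + r i 0 *: u].

Definition robust_feasible_set (r : 'cV[R]_m) : set 'cV[R]_n :=
  [set x | forall Ab, uncertainty_set r Ab -> K (- (Ab.1 *m x + Ab.2))].

Definition admissible_set : set 'cV[R]_m :=
  [set r : 'cV[R]_m | (forall i : 'I_m, 0 <= r i 0) /\ robust_feasible_set r !=set0].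

(* Taken in \bar R: the real-valued sup and inf default to 0 on sets that are
   empty or unbounded. *)
Definition robust_radius : \bar R :=
  ereal_sup [set alpha%:E | alpha in
    [set alpha : R | 0 <= alpha /\ admissible_set (const_mx alpha)]].

End Radius.

Section SDP.
Variables (q m n : nat) (L : symmx R q -> 'cV[R]_m).
Variables (A0 : 'M[R]_(m, n)) (b0 : 'cV[R]_m).

Definition psd_cone : set 'cV[R]_m := L @` [set M : symmx R q | psdmx M].

Definition sdp_matrix (t : R) (z : 'cV[R]_n) (s : R) : 'M[R]_(n + 1 + 1) :=
  block_mx (block_mx t%:M 0 0 t%:M) (col_mx z s%:M)
           (row_mx z^T s%:M) 1%:M.

Definition sdp_feasible (z : 'cV[R]_n) (s t : R) (lambda : 'cV[R]_m)
    (Lambda : symmx R q) : Prop :=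
  [/\ psdmx (sdp_matrix t z s),
      z = A0^T *m lambda,
      - (b0^T *m lambda) 0 0 <= s,
      lambda = L Lambda &
      psdmx Lambda /\ \tr (Lambda : 'M[R]_q) = 1].

Definition sdp_value : \bar R :=
  ereal_inf [set t%:E | t in
    [set t : R | exists z s lambda Lambda, sdp_feasible z s t lambda Lambda]].

End SDP.
End RobustFeasibility.

(* Main.v *)
(* The constraints of the semidefinite program say that t >= |(z, s)|^2 with
   z = A^T lambda and s >= - b^T lambda, so its value is the squared distance d^2
   from the origin to a convex set E.

   Upper bound: if x is feasible for radius alpha, perturb row i along (x, 1) with
   the sign of lambda_i; pairing with lambda gives
     alpha |lambda|_1 |(x, 1)| <= - z^T x + s <= |(z, s)| |(x, 1)|,
   and |lambda|_1 >= |lambda|_2 >= Tr Lambda / sqrt q.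

   Lower bound: a nearly closest point (z0, s0) of E to the origin nearly
   satisfies the variational inequality of the projection; the direction
   (- z0, s0), corrected by a small multiple of (x0, 1) for the given feasible
   point x0, is proportional to some (x, 1) with
   - lambda^T (A x + b) >= beta |(x, 1)| for any prescribed beta < d and all
   lambda = L (v v^T), |v| = 1. Since |lambda_i| <= 1, perturbations of radius
   beta / m cannot change the sign of lambda^T (A x + b). *)

Require Import Defs.
From HB Require Import structures.
From mathcomp Require Import all_boot all_order all_algebra.
From mathcomp Require Import boolp classical_sets reals ereal.
From mathcomp Require Import ring lra.

Import Order.TTheory GRing.Theory Num.Theory.
Local Open Scope classical_set_scope.
Local Open Scope ring_scope.

(** * Euclidean inner product and norm on column vectors *)

Section DotProduct.
Set Implicit Arguments.
Unset Strict Implicit.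
Variable R : realType.

Definition dot k (u v : 'cV[R]_k) : R := (u^T *m v) 0 0.

Definition enorm k (u : 'cV[R]_k) : R := Num.sqrt (dot u u).

Lemma dotE k (u v : 'cV[R]_k) : dot u v = \sum_i u i 0 * v i 0.
Proof. by rewrite /dot mxE; apply: eq_bigr => i _; rewrite mxE. Qed.

Lemma dotC k (u v : 'cV[R]_k) : dot u v = dot v u.
Proof. by rewrite !dotE; apply: eq_bigr => i _; rewrite mulrC. Qed.

Lemma dotDr k (u v w : 'cV[R]_k) : dot u (v + w) = dot u v + dot u w.
Proof. by rewrite /dot mulmxDr mxE. Qed.

Lemma dotDl k (u v w : 'cV[R]_k) : dot (v + w) u = dot v u + dot w u.
Proof. by rewrite ![dot _ u]dotC dotDr. Qed.

Lemma dotZr k a (u v : 'cV[R]_k) : dot u (a *: v) = a * dot u v.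
Proof. by rewrite /dot -scalemxAr mxE. Qed.

Lemma dotZl k a (u v : 'cV[R]_k) : dot (a *: v) u = a * dot v u.
Proof. by rewrite ![dot _ u]dotC dotZr. Qed.

Lemma dotNr k (u v : 'cV[R]_k) : dot u (- v) = - dot u v.
Proof. by rewrite /dot mulmxN mxE. Qed.

Lemma dotNl k (u v : 'cV[R]_k) : dot (- v) u = - dot v u.
Proof. by rewrite ![dot _ u]dotC dotNr. Qed.

Definition dot_linear := (dotDr, dotDl, dotZr, dotZl, dotNr, dotNl).

Lemma dot_mulmxl k l (A : 'M[R]_(k, l)) u v :
  dot (A *m u) v = dot u (A^T *m v).
Proof. by rewrite /dot trmx_mul mulmxA. Qed.

Lemma dot_col_mx k l (u u' : 'cV[R]_k) (v v' : 'cV[R]_l) :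
  dot (col_mx u v) (col_mx u' v') = dot u u' + dot v v'.
Proof. by rewrite /dot tr_col_mx mul_row_col mxE. Qed.

Lemma dot_scalar (a b : R) : dot a%:M b%:M = a * b.
Proof. by rewrite /dot tr_scalar_mx -scalar_mxM mxE eqxx mulr1n. Qed.

Lemma dot_ge0 k (u : 'cV[R]_k) : 0 <= dot u u.
Proof. by rewrite dotE sumr_ge0// => i _; rewrite -expr2 sqr_ge0. Qed.

Lemma dot_eq0 k (u : 'cV[R]_k) : dot u u = 0 -> u = 0.
Proof.
rewrite dotE => /eqP; rewrite psumr_eq0; last first.
  by move=> i _; rewrite -expr2 sqr_ge0.
move=> /allP u0; apply/colP => i; rewrite mxE; apply/eqP.
by have := u0 i (mem_index_enum i); rewrite /= -expr2 sqrf_eq0.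
Qed.

(** Cauchy-Schwarz: expand the square of the norm of [(v,v) u - (u,v) v] and cancel one factor
    [(v,v)]. *)
Lemma dot_sqr_le k (u v : 'cV[R]_k) : dot u v ^+ 2 <= dot u u * dot v v.
Proof.
have [v0|v_neq0] := eqVneq (dot v v) 0.
  by rewrite (dot_eq0 v0) -(scale0r (0 : 'cV[R]_k)) !dotZr !mul0r mulr0 expr0n.
have v_gt0 : 0 < dot v v by rewrite lt_def v_neq0 dot_ge0.
have := dot_ge0 (dot v v *: u - dot u v *: v).
rewrite !dot_linear [dot v u]dotC => h.
rewrite -(ler_pM2l v_gt0) -subr_ge0; apply: le_trans h _.
by rewrite le_eqVlt; apply/orP; left; apply/eqP; ring.
Qed.

Lemma enorm_ge0 k (u : 'cV[R]_k) : 0 <= enorm u.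
Proof. exact: sqrtr_ge0. Qed.

Lemma sqr_enorm k (u : 'cV[R]_k) : enorm u ^+ 2 = dot u u.
Proof. by rewrite sqr_sqrtr ?dot_ge0. Qed.

Lemma ler_dot_enorm k (u v : 'cV[R]_k) : `|dot u v| <= enorm u * enorm v.
Proof.
by rewrite -sqrtrM ?dot_ge0// -sqrtr_sqr ler_wsqrtr// dot_sqr_le.
Qed.

Lemma enormD k (u v : 'cV[R]_k) : enorm (u + v) <= enorm u + enorm v.
Proof.
rewrite -ler_sqr ?nnegrE ?addr_ge0 ?enorm_ge0// sqrrD !sqr_enorm !dot_linear.
have := le_trans (ler_norm _) (ler_dot_enorm u v).
by rewrite [dot v u]dotC; lra.
Qed.

Lemma enormZ k a (u : 'cV[R]_k) : enorm (a *: u) = `|a| * enorm u.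
Proof.
by rewrite /enorm !dot_linear mulrA -expr2 sqrtrM ?sqr_ge0// sqrtr_sqr.
Qed.

Lemma coord_le1 k (u : 'cV[R]_k) i : dot u u = 1 -> `|u i 0| <= 1.
Proof.
move=> u1; rewrite -(@ler_pXn2r _ 2) ?nnegrE// expr1n real_normK ?num_real//.
rewrite -u1 dotE (bigD1 i)//= -expr2 lerDl sumr_ge0// => j _.
by rewrite -expr2 sqr_ge0.
Qed.

Lemma dot_le_sum_norm k (u : 'cV[R]_k) : dot u u <= (\sum_i `|u i 0|) ^+ 2.
Proof.
rewrite dotE expr2 mulr_suml; apply: ler_sum => i _.
rewrite -expr2 -real_normK ?num_real// expr2 ler_wpM2l//.
by rewrite (bigD1 i)//= lerDl sumr_ge0.
Qed.

Lemma dot_mulmx_le k l (P : 'M[R]_(k, l)) (u : 'cV[R]_l) :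
  dot (P *m u) (P *m u)
    <= (\sum_j dot (row j P)^T (row j P)^T) * dot u u.
Proof.
rewrite dotE mulr_suml; apply: ler_sum => j _.
suff -> : (P *m u) j 0 = dot (row j P)^T u by rewrite -expr2 dot_sqr_le.
by rewrite /dot trmxK !mxE; apply: eq_bigr => i _; rewrite mxE.
Qed.

Lemma enorm_homog_gt0 k (x : 'cV[R]_k) : 0 < enorm (col_mx x (1%:M : 'M_1)).
Proof.
by rewrite sqrtr_gt0 dot_col_mx dot_scalar mulr1 ltr_wpDl ?dot_ge0.
Qed.

End DotProduct.

(** * Positive semidefinite matrices, and the matrix constraint of the program *)

Section PSD.
Set Implicit Arguments.
Unset Strict Implicit.
Variable R : realType.

Lemma symmetricmxP k (M : 'M[R]_k) : M \is symmetricmx <-> M^T = M.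
Proof.
have := symmx_predE M; rewrite inE => ->.
by split=> [/eqP|->].
Qed.

Lemma psdmxP k (M : 'M[R]_k) :
  psdmx M <-> M^T = M /\ forall v, 0 <= dot v (M *m v).
Proof.
rewrite /psdmx symmetricmxP; split=> -[MT M0]; split=> // v; have := M0 v.
  by rewrite /dot mulmxA.
by rewrite /dot mulmxA.
Qed.

Lemma psdmx_unit k (M : 'M[R]_k) : M^T = M ->
  (forall v, dot v v = 1 -> 0 <= dot v (M *m v)) -> psdmx M.
Proof.
move=> MT M1; apply/psdmxP; split=> // v.
have [v0|v_neq0] := eqVneq (dot v v) 0.
  by rewrite (dot_eq0 v0) mulmx0 -(scale0r (0 : 'cV[R]_k)) dotZr mul0r.
have v_gt0 : 0 < dot v v by rewrite lt_def v_neq0 dot_ge0.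
have n_gt0 : 0 < enorm v by rewrite sqrtr_gt0.
have := M1 ((enorm v)^-1 *: v).
rewrite -scalemxAr !dot_linear -sqr_enorm => h.
have e : (enorm v)^-1 * ((enorm v)^-1 * enorm v ^+ 2) = 1.
  by field; rewrite gt_eqF.
by have := h e; rewrite !pmulr_rge0 ?invr_gt0.
Qed.

Lemma psdmx_vvT k (v : 'cV[R]_k) : psdmx (v *m v^T).
Proof.
apply/psdmxP; split; first by rewrite trmx_mul trmxK.
move=> w; rewrite -mulmxA (_ : v^T *m w = (dot v w)%:M); last first.
  by rewrite /dot -mx11_scalar.
by rewrite mul_mx_scalar dotZr dotC -expr2 sqr_ge0.
Qed.

Lemma mxtrace_vvT k (v : 'cV[R]_k) (M : 'M[R]_k) :
  \tr (v *m v^T *m M) = dot v (M *m v).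
Proof. by rewrite -mulmxA mxtrace_mulC /dot mulmxA -trace_mx11. Qed.

Lemma dot_block k (a c : R) (w y : 'cV[R]_k) (M : 'M[R]_k) :
  dot (col_mx c%:M y) (block_mx a%:M w^T w M *m col_mx c%:M y)
  = a * c ^+ 2 + 2 * c * dot w y + dot y (M *m y).
Proof.
rewrite mul_block_col dot_col_mx -scalar_mxM mul_mx_scalar.
rewrite (_ : w^T *m y = (dot w y)%:M); last by rewrite /dot -mx11_scalar.
rewrite !dot_linear !dot_scalar [dot y w]dotC; ring.
Qed.

(* Cholesky factorisation, by induction through the Schur complement. *)
Lemma psdmx_factor k (M : 'M[R]_k) :
  psdmx M -> exists B : 'M[R]_k, M = B^T *m B.
Proof.
elim: k M => [|k IH] M.
  by move=> _; exists 0; rewrite [LHS]flatmx0 [RHS]flatmx0.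
rewrite -[k.+1]/(1 + k)%N in M *.
move=> /psdmxP[MT M0].
pose a := ulsubmx M 0 0; pose w := dlsubmx M; pose M' := drsubmx M.
have wT : ursubmx M = w^T by rewrite /w trmx_dlsub MT.
have MT' : M'^T = M' by rewrite /M' trmx_drsub MT.
have ME : M = block_mx a%:M w^T w M'.
  by rewrite -wT /a -mx11_scalar submxK.
have pos c y : 0 <= a * c ^+ 2 + 2 * c * dot w y + dot y (M' *m y).
  by rewrite -dot_block -ME.
have a_ge0 : 0 <= a.
  have := pos 1 0; rewrite mulmx0 -(scale0r (0 : 'cV[R]_k)) !dotZr; lra.
have w0 : a = 0 -> w = 0.
  move=> a0; apply: dot_eq0; apply/eqP; rewrite eq_le dot_ge0 andbT.
  rewrite leNgt; apply/negP => ww.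
  (* With [a = 0] the form is affine in [c]; this [c] gives it the value -1. *)
  have := pos (- (dot w (M' *m w) + 1) / (2 * dot w w)) w; rewrite a0.
  rewrite (_ : 2 * _ * _ = - (dot w (M' *m w) + 1)); first by lra.
  by field; rewrite gt_eqF.
have /IH[C CE] : psdmx (M' - a^-1 *: (w *m w^T)).
  apply/psdmxP; split.
    by rewrite linearB linearZ /= trmx_mul trmxK MT'.
  move=> y; rewrite mulmxBl -scalemxAl -mulmxA.
  rewrite (_ : w^T *m y = (dot w y)%:M); last by rewrite /dot -mx11_scalar.
  rewrite mul_mx_scalar !dot_linear [dot y w]dotC.
  (* If [a = 0], then [a^-1 = 0] and the Schur complement is [M'] itself. Otherwise its form at [y]
     is the minimum over [c] of the full form, attained at [c = - (w,y) / a]. *)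
  have [a0|a_neq0] := eqVneq a 0.
    have := pos 0 y; rewrite a0 invr0; lra.
  have := pos (- dot w y / a) y.
  by congr (_ <= _); field.
have sK : Num.sqrt a *: ((Num.sqrt a)^-1 *: w) = w.
  rewrite scalerA; have [a0|a_neq0] := eqVneq a 0.
    by rewrite (w0 a0) scaler0.
  by rewrite mulfV ?scale1r// sqrtr_eq0 -ltNge lt_def a_neq0.
exists (block_mx (Num.sqrt a)%:M ((Num.sqrt a)^-1 *: w^T) 0 C).
have vT : ((Num.sqrt a)^-1 *: w^T)^T = (Num.sqrt a)^-1 *: w.
  by rewrite linearZ /= trmxK.
rewrite tr_block_mx mulmx_block ME vT !tr_scalar_mx !trmx0.
rewrite !mul0mx !mulmx0 !addr0 -scalar_mxM -expr2 sqr_sqrtr//.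
rewrite mul_scalar_mx mul_mx_scalar sK.
have -> : Num.sqrt a *: ((Num.sqrt a)^-1 *: w^T) = w^T.
  by apply: trmx_inj; rewrite linearZ /= vT trmxK sK.
rewrite -CE -scalemxAr -scalemxAl scalerA -invfM -expr2 sqr_sqrtr//.
by rewrite addrC subrK.
Qed.

(** With [M = B^T B], the trace is the sum of the form of [N] over the rows of [B]. This is the half
    of self-duality of the cone behind the upper bound. *)
Lemma psdmx_tr_ge0 k (M N : 'M[R]_k) : psdmx M -> psdmx N -> 0 <= \tr (M *m N).
Proof.
move=> /psdmx_factor[B ->] /psdmxP[_ N0].
rewrite -mulmxA mxtrace_mulC -mulmxA sumr_ge0// => i _.
have := N0 (row i B)^T; congr (_ <= _).
rewrite /dot trmxK !mxE; apply: eq_bigr => j _; rewrite !mxE.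
by congr (_ * _); apply: eq_bigr => l _; rewrite !mxE.
Qed.

Lemma psdmxD k (M N : 'M[R]_k) : psdmx M -> psdmx N -> psdmx (M + N).
Proof.
move=> /psdmxP[MT M0] /psdmxP[NT N0]; apply/psdmxP; split.
  by rewrite linearD /= MT NT.
by move=> v; rewrite mulmxDl dotDr addr_ge0.
Qed.

Lemma psdmxZ k a (M : 'M[R]_k) : 0 <= a -> psdmx M -> psdmx (a *: M).
Proof.
move=> a0 /psdmxP[MT M0]; apply/psdmxP; split; first by rewrite linearZ/= MT.
by move=> v; rewrite -scalemxAl dotZr mulr_ge0.
Qed.

(** Cauchy-Schwarz for the diagonal against the all-ones vector; by symmetry [\tr (M *m M)] is the
    sum of all squared entries, diagonal ones included. It is the source of the factor [sqrt q]. *)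
Lemma sqr_mxtrace_le k (M : 'M[R]_k) : M^T = M ->
  \tr M ^+ 2 <= k%:R * \tr (M *m M).
Proof.
move=> MT; have := dot_sqr_le (const_mx 1) (\col_i M i i).
rewrite !dotE.
under eq_bigr do rewrite !mxE mul1r.
under [X in _ <= X * _ -> _]eq_bigr do rewrite !mxE mul1r.
rewrite sumr_const card_ord => /le_trans; apply.
rewrite ler_wpM2l//; apply: ler_sum => i _.
rewrite !mxE (bigD1 i)//= lerDl sumr_ge0// => j _.
by rewrite -[in X in _ * X]MT !mxE -expr2 sqr_ge0.
Qed.

Lemma sdp_matrixE n (t : R) (z : 'cV[R]_n) s :
  sdp_matrix t z s = block_mx t%:M (col_mx z s%:M) (col_mx z s%:M)^T 1%:M.
Proof. by rewrite /sdp_matrix tr_col_mx tr_scalar_mx -scalar_mx_block. Qed.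

Lemma psdmx_sdp_matrix n (t : R) (z : 'cV[R]_n) s :
  psdmx (sdp_matrix t z s) <-> dot z z + s ^+ 2 <= t.
Proof.
have -> : dot z z + s ^+ 2 = dot (col_mx z s%:M) (col_mx z s%:M).
  by rewrite dot_col_mx dot_scalar.
rewrite sdp_matrixE; set e := col_mx z s%:M.
have form y c : dot (col_mx y c%:M) (block_mx t%:M e e^T 1%:M *m col_mx y c%:M)
    = t * dot y y + 2 * c * dot e y + c ^+ 2.
  rewrite mul_block_col dot_col_mx mul1mx mul_scalar_mx mul_mx_scalar.
  rewrite (_ : e^T *m y = (dot e y)%:M); last by rewrite /dot -mx11_scalar.
  rewrite !dot_linear !dot_scalar [dot y e]dotC; ring.
split=> [/psdmxP[_ pos]|le_et].
  have [e0|e_neq0] := eqVneq (dot e e) 0.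
    have := pos (col_mx (col_mx 0 1%:M) 0%:M).
    rewrite form e0 dot_col_mx dot_scalar -(scale0r (0 : 'cV[R]_n)) dotZr.
    by rewrite !mul0r; lra.
  have e_gt0 : 0 < dot e e by rewrite lt_def e_neq0 dot_ge0.
  (* At this vector the form equals [|e|^2 (t - |e|^2)]. *)
  have := pos (col_mx (- e) (dot e e)%:M).
  rewrite form !dot_linear => h; rewrite -(ler_pM2r e_gt0); nra.
apply/psdmxP; split=> [|v].
  by rewrite tr_block_mx trmxK !tr_scalar_mx.
rewrite -[v]vsubmxK [dsubmx v]mx11_scalar form.
set y := usubmx v; set c := dsubmx v 0 0.
(* Since [t |y|^2 >= (e,y)^2], the form is at least [((e,y) + c)^2]. *)
have := le_trans (dot_sqr_le e y) (ler_wpM2r (dot_ge0 y) le_et).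
by have := sqr_ge0 (dot e y + c); rewrite sqrrD; lra.
Qed.

End PSD.

(** * Rank-one matrices as test vectors for the cone *)

Section RobustRadius.
Set Implicit Arguments.
Unset Strict Implicit.
Variables (R : realType) (q m n : nat) (L : {linear symmx R q -> 'cV[R]_m}).
Hypothesis L_bij : bijective L.
Hypothesis L_isometry : forall M1 M2 : symmx R q,
  dot (L M1) (L M2) = \tr ((M1 : 'M[R]_q) *m (M2 : 'M[R]_q)).
Variables (A0 : 'M[R]_(m, n)) (b0 : 'cV[R]_m).

Lemma symmx_tr (M : symmx R q) : (M : 'M[R]_q)^T = M.
Proof. by apply/eqP; rewrite -symmx_predE; case: M. Qed.

Fact vvT_sym (v : 'cV[R]_q) : v *m v^T \in @symmx_pred R q.
Proof. by rewrite symmx_predE trmx_mul trmxK. Qed.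

Definition vvT (v : 'cV[R]_q) : symmx R q := SymMx (vvT_sym v).

(** Turns the quadratic form of [M] into a pairing in [R^m], so that membership in the cone is
    tested against the vectors [L (vvT v)]. *)
Lemma dot_vvT v (M : symmx R q) :
  dot (L (vvT v)) (L M) = dot v ((M : 'M[R]_q) *m v).
Proof. by rewrite L_isometry mxtrace_vvT. Qed.

Lemma dot_vvT_unit v : dot v v = 1 -> dot (L (vvT v)) (L (vvT v)) = 1.
Proof.
move=> v1; rewrite dot_vvT /= -mulmxA (_ : v^T *m v = 1%:M) ?mulmx1//.
by rewrite [LHS]mx11_scalar -/(dot v v) v1.
Qed.

Lemma tr_vvT_unit v : dot v v = 1 -> \tr (vvT v : 'M[R]_q) = 1.
Proof. by move=> v1; rewrite -[vvT v : 'M[R]_q]mulmx1 mxtrace_vvT mul1mx. Qed.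

(** * Upper bound on the radius *)

Lemma admissible_sqr_le alpha z s t lambda (Lambda : symmx R q) :
  0 <= alpha ->
  admissible_set (psd_cone L) A0 b0 (const_mx alpha) ->
  sdp_feasible L A0 b0 z s t lambda Lambda -> alpha ^+ 2 <= q%:R * t.
Proof.
move=> a0 [_ [x xF]] [/psdmx_sdp_matrix zt zE sb lE [Lpsd trL]].
pose p : 'cV[R]_(n + 1) := col_mx x 1%:M; pose X := enorm p.
have X_gt0 : 0 < X := enorm_homog_gt0 x.
have XE : X ^+ 2 = dot x x + 1.
  by rewrite sqr_enorm dot_col_mx dot_scalar mulr1.
(* The worst perturbation of row [i] is the unit multiple of [(x, 1)] whose
   sign is that of [lambda_i]. *)
pose sigma : 'cV[R]_m := \col_i Num.sg (lambda i 0).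
pose c := alpha / X.
have U : uncertainty_set A0 b0 (const_mx alpha)
    (A0 + c *: (sigma *m x^T), b0 + c *: sigma).
  move=> i; exists (X^-1 *: (sigma i 0 *: p^T)).
    rewrite /euclidean_unit_ball /= -[leRHS]sqrtr1 ler_wsqrtr//.
    under eq_bigr do rewrite mxE mxE [sigma _ _]mxE [p^T _ _]mxE.
    rewrite (_ : \sum_i _ =
      X^-1 ^+ 2 * Num.sg (lambda i 0) ^+ 2 * dot p p); last first.
      by rewrite dotE mulr_sumr; apply: eq_bigr => j _; ring.
    rewrite -sqr_enorm -/X sqr_sg mulrAC -exprMn.
    rewrite (mulVf (lt0r_neq0 X_gt0)) expr1n mul1r.
    (* The squared sign is 0 where [lambda] vanishes, so the norm is at most 1, not always equal to
       1. *)
    by rewrite lern1 leq_b1.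
  rewrite /= (_ : row_mx _ _ = row_mx A0 b0 + c *: (sigma *m p^T)).
    rewrite linearD linearZ /= row_mul mxE scalerA -/c; congr (_ + _ *: _).
    by apply/rowP => j; rewrite !mxE big_ord1 !mxE.
  by rewrite tr_col_mx tr_scalar_mx mul_mx_row mulmx1 scale_row_mx add_row_mx.
have [M Mpsd ME] := xF _ U.
have := psdmx_tr_ge0 Lpsd Mpsd; rewrite -L_isometry ME -lE /=.
pose l1 := \sum_i `|lambda i 0|.
have l1E : dot lambda sigma = l1.
  by rewrite dotE; apply: eq_bigr => i _; rewrite mxE mulrC -normrEsg.
rewrite mulmxDl -scalemxAl -mulmxA.
rewrite (_ : x^T *m x = (dot x x)%:M); last by rewrite /dot -mx11_scalar.
rewrite mul_mx_scalar !dot_linear l1E.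
rewrite [dot lambda (A0 *m x)]dotC dot_mulmxl -zE.
have cE : c * (dot x x) + c = alpha * X.
  rewrite -[X in _ + X]mulr1 -mulrDr -XE /c; field; exact: lt0r_neq0.
pose e : 'cV[R]_(n + 1) := col_mx z s%:M.
(* The pairing of [(z, s)] with [(- x, 1)] dominates [alpha * l1 * X], and [(- x, 1)] has the same
   norm [X] as [(x, 1)]. *)
have := le_trans (ler_norm _) (ler_dot_enorm e (col_mx (- x) 1%:M)).
have -> : enorm (col_mx (- x) 1%:M) = X.
  by rewrite /X /enorm !dot_col_mx !dot_linear opprK.
rewrite dot_col_mx dot_scalar !dot_linear mulr1 [dot z x]dotC => CS pos.
have {}sb : - dot lambda b0 <= s by rewrite dotC.
have l1_ge0 : 0 <= l1 by rewrite sumr_ge0.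
have le_e : alpha * l1 <= enorm e.
  rewrite -(ler_pM2r X_gt0) mulrAC -cE; lra.
have le_t : (alpha * l1) ^+ 2 <= t.
  apply: le_trans zt; rewrite -[s ^+ 2]dot_scalar -dot_col_mx -sqr_enorm.
  by rewrite ler_sqr ?nnegrE ?enorm_ge0 ?mulr_ge0.
have := sqr_mxtrace_le (symmx_tr Lambda).
rewrite trL expr1n -L_isometry -lE => tr1.
have q1 : 1 <= q%:R * l1 ^+ 2.
  by apply: le_trans tr1 _; rewrite ler_wpM2l// dot_le_sum_norm.
apply: (@le_trans _ _ (q%:R * (alpha * l1) ^+ 2)); last by rewrite ler_wpM2l.
by rewrite exprMn mulrCA ler_peMr// sqr_ge0.
Qed.

(** * Lower bound: effect of perturbations at a point with a margin *)

Lemma uncertainty_dev alpha Ab x i : 0 <= alpha ->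
  uncertainty_set A0 b0 (const_mx alpha) Ab ->
  `|(Ab.1 *m x + Ab.2 - (A0 *m x + b0)) i 0|
    <= alpha * enorm (col_mx x (1%:M : 'M_1)).
Proof.
set p := col_mx x 1%:M.
have rowE (A : 'M[R]_(m, n)) b :
    (row i (row_mx A b) *m p) 0 0 = (A *m x + b) i 0.
  by rewrite -row_mul mul_row_col mulmx1 mxE.
(* Pairing the perturbed row with [(x, 1)] gives the deviation [alpha * (u, p)], ready for
   Cauchy-Schwarz. *)
move=> a0 /(_ i)[u u1 /(congr1 (fun r => (r *m p) 0 0))].
rewrite rowE mulmxDl -scalemxAl => E.
rewrite [RHS]mxE rowE [(_ *: (u *m p)) _ _]mxE [const_mx _ _ _]mxE in E.
rewrite mxE [(- (_ + b0)) _ _]mxE E addrAC subrr add0r normrM ger0_norm//.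
rewrite ler_wpM2l//.
have := ler_dot_enorm u^T p.
rewrite {1}/dot trmxK => /le_trans; apply.
rewrite ler_piMl ?enorm_ge0// /enorm dotE.
by under eq_bigr do rewrite !mxE -expr2.
Qed.

(** The coordinates of [L (vvT v)] are at most 1 in absolute value and each of the [m] rows deviates
    by at most [alpha |(x, 1)|]; the margin absorbs their sum. This is where the factor [1 / m] is
    lost. *)
Lemma admissible_center alpha x : 0 <= alpha ->
  (forall v, dot v v = 1 -> alpha * m%:R * enorm (col_mx x (1%:M : 'M_1))
     <= - dot (L (vvT v)) (A0 *m x + b0)) ->
  admissible_set (psd_cone L) A0 b0 (const_mx alpha).
Proof.
move=> a0 xP; split=> [i|]; first by rewrite mxE.
exists x => Ab AbU; have [Linv LinvK LK] := L_bij.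
set y := - _; exists (Linv y); last exact: LK.
apply: psdmx_unit => [|v v1]; first exact: symmx_tr.
rewrite -dot_vvT LK /y.
pose w := Ab.1 *m x + Ab.2 - (A0 *m x + b0).
rewrite -[X in - X](subrK (A0 *m x + b0)) -/w opprD dotDr !dotNr.
set X := enorm _ in xP.
suff : dot (L (vvT v)) w <= alpha * m%:R * X by have := xP v v1; lra.
apply: (@le_trans _ _ (\sum_(i < m) alpha * X)); last first.
  by rewrite sumr_const card_ord mulrAC mulr_natr.
rewrite dotE; apply: ler_sum => i _; apply: le_trans (ler_norm _) _.
rewrite normrM -[leRHS]mul1r ler_pM//; last exact: uncertainty_dev.
exact/coord_le1/dot_vvT_unit.
Qed.

(** * Lower bound: geometry of the points [(z, s)] of the program *)

Lemma sdp_feasible_vvT v : dot v v = 1 ->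
  let lambda := L (vvT v) in
  let e := col_mx (A0^T *m lambda) (- dot b0 lambda)%:M : 'cV[R]_(n + 1) in
  sdp_feasible L A0 b0 (A0^T *m lambda) (- dot b0 lambda) (dot e e)
    lambda (vvT v).
Proof.
move=> v1 lambda e; split=> //; last first.
  by split; [exact: psdmx_vvT|exact: tr_vvT_unit].
by apply/psdmx_sdp_matrix; rewrite dot_col_mx dot_scalar.
Qed.

(** Convexity of the set of points [(z, s)]; taking [t] as small as possible, the squared norm,
    makes the program a minimum-norm problem. *)
Lemma sdp_feasible_segment tau z0 s0 t0 lambda0 (Lambda0 : symmx R q)
    z1 s1 t1 lambda1 (Lambda1 : symmx R q) :
  0 <= tau <= 1 ->
  sdp_feasible L A0 b0 z0 s0 t0 lambda0 Lambda0 ->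
  sdp_feasible L A0 b0 z1 s1 t1 lambda1 Lambda1 ->
  let e0 := col_mx z0 s0%:M : 'cV[R]_(n + 1) in
  let e1 := col_mx z1 s1%:M : 'cV[R]_(n + 1) in
  exists z s lambda Lambda, sdp_feasible L A0 b0 z s
    (dot (e0 + tau *: (e1 - e0)) (e0 + tau *: (e1 - e0))) lambda Lambda.
Proof.
move=> /andP[tau0 tau1] [_ z0E s0b l0E [L0 tr0]] [_ z1E s1b l1E [L1 tr1]] e0 e1.
exists (z0 + tau *: (z1 - z0)), (s0 + tau * (s1 - s0)).
exists (lambda0 + tau *: (lambda1 - lambda0)).
exists (Lambda0 + tau *: (Lambda1 - Lambda0)); split.
- apply/psdmx_sdp_matrix; rewrite -[(_ + _) ^+ 2]dot_scalar -dot_col_mx.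
  rewrite le_eqVlt; apply/orP; left; apply/eqP.
  rewrite /e0 /e1 opp_col_mx add_col_mx scale_col_mx add_col_mx.
  by rewrite -raddfB scale_scalar_mx -raddfD.
- by rewrite mulmxDr -scalemxAr mulmxBr -z0E -z1E.
- move: s0b s1b; rewrite -!/(dot _ _) dotDr dotZr dotDr dotNr => s0b s1b.
  have := ler_wpM2l tau0 s1b.
  have := ler_wpM2l (_ : 0 <= 1 - tau) s0b; rewrite subr_ge0 => /(_ tau1).
  nra.
- by rewrite l0E l1E -raddfB -linearZ_LR -raddfD.
- have -> : (Lambda0 + tau *: (Lambda1 - Lambda0) : symmx R q) =
      ((1 - tau) *: (Lambda0 : 'M[R]_q) + tau *: (Lambda1 : 'M[R]_q)) :> 'M[R]_q.
    by rewrite /= scalerBl scale1r scalerBr addrA addrAC.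
  split; first by apply: psdmxD; apply: psdmxZ; rewrite ?subr_ge0.
  by rewrite linearD !linearZ /= tr0 tr1 !mulr1 subrK.
Qed.

(** These points are images of unit vectors under one fixed matrix. A bound uniform in [v] lets the
    step length [tau] below be chosen before [v]. *)
Lemma vvT_points_bounded : exists2 C, 0 <= C & forall v, dot v v = 1 ->
  let lambda := L (vvT v) in
  let e := col_mx (A0^T *m lambda) (- dot b0 lambda)%:M : 'cV[R]_(n + 1) in
  dot e e <= C.
Proof.
pose P := col_mx A0^T (- b0^T).
exists (\sum_j dot (row j P)^T (row j P)^T).
  by apply: sumr_ge0 => j _; exact: dot_ge0.
move=> v v1 /=; set lambda := L _; set e := col_mx _ _.
have -> : e = P *m lambda.
  rewrite /e mul_col_mx mulNmx raddfN /=; congr (col_mx _ (- _)).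
  by rewrite [RHS]mx11_scalar.
by apply: le_trans (dot_mulmx_le P lambda) _; rewrite dot_vvT_unit// mulr1.
Qed.

(* A nearly optimal point [e0] of the program nearly satisfies the variational
   inequality characterising the projection of the origin. *)
Lemma near_projection f g : 0 <= f -> 0 < g ->
  (forall z s t lambda Lambda,
    sdp_feasible L A0 b0 z s t lambda Lambda -> f <= t) ->
  (forall eps, 0 < eps -> exists z s t lambda Lambda,
    sdp_feasible L A0 b0 z s t lambda Lambda /\ t <= f + eps) ->
  exists z0 s0, let e0 := col_mx z0 s0%:M : 'cV[R]_(n + 1) in
    [/\ 0 <= s0, f <= dot e0 e0 &
      forall v, dot v v = 1 -> let lambda := L (vvT v) in
        dot e0 e0 - g
        <= dot e0 (col_mx (A0^T *m lambda) (- dot b0 lambda)%:M)].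
Proof.
move=> f0 g0 f_lb f_inf; have [C C0 Cv] := vvT_points_bounded.
(* [K] will bound [1 + |e - e0|^2], by [|e - e0|^2 <= 2 |e|^2 + 2 |e0|^2] and [|e0|^2 <= f + 1];
   [tau] satisfies [tau <= 1] and [tau * K <= g]. *)
pose K := 3 + 2 * C + 2 * f; pose tau := g / (g + K).
have gK : 0 < g + K by rewrite /K; lra.
have tau0 : 0 < tau by rewrite divr_gt0.
have tau1 : tau <= 1 by rewrite ler_pdivrMr// mul1r /K; lra.
have tauK : tau * K <= g.
  by rewrite mulrAC ler_pdivrMr// ler_wpM2l// /K; lra.
have [|z0 [s1 [t1 [l0 [L0 [[M1 z0E s1b l0E L0P] t1_le]]]]]] := f_inf (tau ^+ 2).
  by rewrite exprn_gt0.
(* Truncating at 0 keeps the lower bound on [s] and does not increase the norm. *)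
pose s0 := Num.max s1 0.
have s0_ge0 : 0 <= s0 by rewrite le_max lexx orbT.
have s0_sqr : s0 ^+ 2 <= s1 ^+ 2.
  by rewrite /s0; case: (leP s1 0) => _//; rewrite expr0n sqr_ge0.
pose e0 : 'cV[R]_(n + 1) := col_mx z0 s0%:M.
have e0E : dot e0 e0 = dot z0 z0 + s0 ^+ 2 by rewrite dot_col_mx dot_scalar.
have e0_le : dot e0 e0 <= f + tau ^+ 2.
  rewrite e0E; move/psdmx_sdp_matrix: M1; lra.
have feas0 : sdp_feasible L A0 b0 z0 s0 (dot e0 e0) l0 L0.
  split=> //; first by apply/psdmx_sdp_matrix; rewrite e0E.
  by rewrite le_max s1b.
have f_e0 : f <= dot e0 e0 := f_lb _ _ _ _ _ feas0.
exists z0, s0; split=> // v v1 /=.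
set lambda := L _; set e := col_mx _ (- _)%:M.
have [z [s [l [L1 feas]]]] : exists z s l L1, sdp_feasible L A0 b0 z s
    (dot (e0 + tau *: (e - e0)) (e0 + tau *: (e - e0))) l L1.
  apply: (sdp_feasible_segment _ feas0 (sdp_feasible_vvT v1)).
  by rewrite tau1 ltW.
have := f_lb _ _ _ _ _ feas; have eC : dot e e <= C := Cv _ v1.
have : 0 <= dot (e + e0) (e + e0) := dot_ge0 _.
rewrite -/e0 !dot_linear [dot e e0]dotC.
set N := dot e0 e0 in e0_le *; set p := dot e0 e; set E := dot e e in eC *.
move=> pE fE.
have t2 : tau ^+ 2 <= 1 by rewrite expr_le1// ltW.
(* Compares the value at [e0 + tau (e - e0)], at least [f], with [N <= f + tau ^+ 2]. *)
have : tau * (2 * (N - p)) <= tau * (tau * (1 + E + N - 2 * p)) by lra.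
rewrite ler_pM2l// => h.
have : tau * (1 + E + N - 2 * p) <= tau * K.
  by rewrite ler_pM2l// /K; lra.
lra.
Qed.

Lemma sdp_center f beta x0 : 0 <= f -> 0 <= beta < Num.sqrt f ->
  psd_cone L (- (A0 *m x0 + b0)) ->
  (forall z s t lambda Lambda,
    sdp_feasible L A0 b0 z s t lambda Lambda -> f <= t) ->
  (forall eps, 0 < eps -> exists z s t lambda Lambda,
    sdp_feasible L A0 b0 z s t lambda Lambda /\ t <= f + eps) ->
  exists x, forall v, dot v v = 1 ->
    beta * enorm (col_mx x (1%:M : 'M_1))
      <= - dot (L (vvT v)) (A0 *m x + b0).
Proof.
move=> f0 /andP[beta0 beta_lt] [M0 M0psd M0E] f_lb f_inf.
(* The error [g] is spent twice, on the variational inequality and on the correction by [x0]; the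
   total [d (d - beta)] is at most [N (N - beta)]. *)
pose d := Num.sqrt f; pose g := d * (d - beta) / 2.
have d_gt0 : 0 < d := le_lt_trans beta0 beta_lt.
have g_gt0 : 0 < g by rewrite divr_gt0// mulr_gt0// subr_gt0.
have [z0 [s0 [s0_ge0 fN e0v]]] := near_projection f0 g_gt0 f_lb f_inf.
set e0 := col_mx z0 s0%:M in fN e0v.
pose p0 := col_mx x0 (1%:M : 'M[R]_1); pose c := enorm p0.
have c_gt0 : 0 < c := enorm_homog_gt0 x0.
(* Chosen so that [beta * delta * c <= g]; [beta + 1] keeps the denominator positive when
   [beta = 0]. *)
pose delta := g / ((beta + 1) * c).
have beta1 : 0 < beta + 1 by lra.
have delta_gt0 : 0 < delta by rewrite divr_gt0// mulr_gt0.
have delta_le : beta * (delta * c) <= g.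
  have -> : beta * (delta * c) = beta / (beta + 1) * g.
    by rewrite /delta; field; rewrite !lt0r_neq0.
  by rewrite ler_piMl ?(ltW g_gt0)// ler_pdivrMr//; lra.
pose k := s0 + delta; have k_gt0 : 0 < k by rewrite /k; lra.
(* [(k x, k)] is [(- z0, s0) + delta (x0, 1)]; the feasible point [x0] only
   serves to make the last coordinate positive when [s0 = 0]. *)
pose x := k^-1 *: (delta *: x0 - z0); exists x => v v1.
have kx : k *: x = delta *: x0 - z0.
  by rewrite scalerA divff ?lt0r_neq0// scale1r.
set lambda := L (vvT v).
have x0_le : dot lambda (A0 *m x0 + b0) <= 0.
  rewrite -oppr_ge0 -dotNr -M0E dot_vvT.
  by move/psdmxP: M0psd => [_]; exact.
pose N := enorm e0.
have dN : d <= N by rewrite ler_wsqrtr.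
have normx : k * enorm (col_mx x (1%:M : 'M_1)) <= N + delta * c.
  rewrite -[k in k * _]gtr0_norm// -enormZ scale_col_mx kx scalemx1.
  have -> : col_mx (delta *: x0 - z0) k%:M
      = col_mx (- z0) s0%:M + delta *: p0.
    rewrite scale_col_mx add_col_mx scalemx1 -raddfD [- z0 + _]addrC.
    by [].
  apply: le_trans (enormD _ _) _; rewrite enormZ gtr0_norm//.
  by rewrite lerD2r /N /enorm !dot_col_mx !dot_linear opprK.
have kdot : k * - dot lambda (A0 *m x + b0)
    = delta * - dot lambda (A0 *m x0 + b0)
      + dot e0 (col_mx (A0^T *m lambda) (- dot b0 lambda)%:M).
  rewrite dot_col_mx dot_scalar [dot z0 _]dotC dot_mulmxl trmxK !dotDr.
  have -> : dot lambda (A0 *m x) = k^-1 *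
      (delta * dot lambda (A0 *m x0) - dot lambda (A0 *m z0)).
    by rewrite -scalemxAr mulmxBr -scalemxAr !dot_linear.
  rewrite [dot b0 _]dotC /k; field; exact: lt0r_neq0.
rewrite -(ler_pM2l k_gt0) kdot mulrCA.
apply: le_trans (ler_wpM2l beta0 normx) _.
have := e0v v v1; rewrite -sqr_enorm -/N -/lambda /=.
have : 0 <= delta * - dot lambda (A0 *m x0 + b0).
  by rewrite mulr_ge0 ?oppr_ge0// ltW.
have : d * (d - beta) <= N * (N - beta).
  by apply: ler_pM; rewrite ?subr_ge0 ?lerD2r// ltW.
rewrite /g in delta_le *; lra.
Qed.

End RobustRadius.

(** * Assembly of the two bounds in the extended reals *)

Theorem corollary4p1 (R : realType) (q m n : nat) (hq : (1 <= q)%N)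
    (hm : m = (q * (q + 1) %/ 2)%N)
    (L : {linear symmx R q -> 'cV[R]_m}) (hLbij : bijective L)
    (hLtr : forall M1 M2 : symmx R q,
      ((L M1)^T *m L M2) 0 0 = \tr ((M1 : 'M[R]_q) *m (M2 : 'M[R]_q)))
    (A0 : 'M[R]_(m, n)) (b0 : 'cV[R]_m)
    (hfeas : [set x : 'cV[R]_n | psd_cone L (- (A0 *m x + b0))] !=set0) :
  ((2 / (q * (q + 1))%:R)%:E * sqrte (sdp_value L A0 b0)
     <= robust_radius (psd_cone L) A0 b0)%E /\
  (robust_radius (psd_cone L) A0 b0
     <= (Num.sqrt q%:R)%:E * sqrte (sdp_value L A0 b0))%E.
Proof.
have [x0 x0K] := hfeas.
have m2 : (m * 2 = q * (q + 1))%N.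
  by rewrite hm addn1 divnK// dvdn2 oddM /=; case: (odd q).
have m_gt0 : (0 < m)%N.
  by have := muln_gt0 m 2; rewrite m2 muln_gt0 hq addn1 => /esym/andP[].
pose feasible t := exists z s lambda Lambda,
  sdp_feasible L A0 b0 z s t lambda Lambda.
have feas_ge0 t : feasible t -> 0 <= t.
  move=> [z [s [l [L1 [/psdmx_sdp_matrix zt _ _ _ _]]]]].
  by apply: le_trans zt; rewrite addr_ge0 ?dot_ge0 ?sqr_ge0.
(* The value is finite: feasible [t] are nonnegative, and [q >= 1] provides a unit vector, hence a
   feasible point. *)
have [f f0 fE] : exists2 f, 0 <= f & sdp_value L A0 b0 = f%:E.
  have v_ge0 : (0 <= sdp_value L A0 b0)%E.
    by apply: le_ereal_inf_tmp => _ /= [t /feas_ge0 t0 <-]; rewrite lee_fin.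
  have [v v1] : exists v : 'cV[R]_q, dot v v = 1.
    exists (delta_mx (Ordinal hq) 0); rewrite /dot trmx_delta mul_delta_mx.
    by rewrite mxE !eqxx.
  have /= := sdp_feasible_vvT L A0 b0 v1; set t := dot (col_mx _ _) _ => feas.
  have : (sdp_value L A0 b0 < +oo)%E.
    apply: (@le_lt_trans _ _ t%:E); last exact: ltry.
    by apply: ereal_inf_lbound; exists t => //; do 4 eexists; exact: feas.
  case: sdp_value v_ge0 => // r r0 _; by exists r.
have f_lb t : feasible t -> f <= t.
  move=> tP; rewrite -lee_fin -fE; apply: ereal_inf_lbound.
  by exists t.
have f_inf eps : 0 < eps -> exists z s t lambda Lambda,
    sdp_feasible L A0 b0 z s t lambda Lambda /\ t <= f + eps.
  move=> eps0.
  have fin : ereal_inf [set t%:E | t in feasible] \is a fin_num.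
    by rewrite -[ereal_inf _]/(sdp_value L A0 b0) fE.
  have [_ [t [z [s [l [L1 tP]]]] <-] lt_t] := lb_ereal_inf_adherent eps0 fin.
  exists z, s, t, l, L1; split=> //; apply: ltW.
  by move: lt_t; rewrite -[ereal_inf _]/(sdp_value _ _ _) fE lte_fin.
have adm_le alpha : 0 <= alpha ->
    admissible_set (psd_cone L) A0 b0 (const_mx alpha) ->
    (alpha%:E <= robust_radius (psd_cone L) A0 b0)%E.
  by move=> a0 aP; apply: ereal_sup_ubound; exists alpha.
rewrite fE /=; split; last first.
  apply: ge_ereal_sup => _ /= [alpha [a0 aP] <-]; rewrite lee_fin.
  rewrite -(@ler_pXn2r _ 2) ?nnegrE ?mulr_ge0 ?sqrtr_ge0//.
  rewrite exprMn !sqr_sqrtr//.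
  have q_gt0 : 0 < q%:R :> R by rewrite ltr0n.
  rewrite -ler_pdivrMl// -lee_fin -fE.
  apply: le_ereal_inf_tmp => _ /= [t [z [s [l [L1 tP]]]] <-].
  by rewrite lee_fin ler_pdivrMl//; exact: admissible_sqr_le a0 aP tP.
have m_gt0R : 0 < m%:R :> R by rewrite ltr0n.
have -> : 2 / (q * (q + 1))%:R = m%:R^-1 :> R.
  by rewrite -m2 natrM; field; rewrite lt0r_neq0.
rewrite leNgt; apply/negP.
(* Radius 0 is admissible at [x0], which excludes the value [-oo]. *)
have rho_ge0 : (0 <= robust_radius (psd_cone L) A0 b0)%E.
  apply: adm_le => //; split=> [i|]; first by rewrite mxE.
  exists x0 => -[A b] /= AbU.
  have -> : A *m x0 + b = A0 *m x0 + b0.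
    apply/subr0_eq/colP => i; rewrite [RHS]mxE; apply/eqP.
    rewrite -normr_le0.
    by have := uncertainty_dev x0 i (lexx 0) AbU; rewrite mul0r.
  exact: x0K.
case: robust_radius rho_ge0 adm_le => // r; rewrite lee_fin => r0 adm_le.
rewrite lte_fin => r_lt.
(* The midpoint exceeds the supposed radius [r], while [alpha * m < sqrt f] makes it admissible. *)
pose alpha := (r + m%:R^-1 * Num.sqrt f) / 2.
have a_gt : r < alpha by rewrite /alpha; lra.
have a_ge0 : 0 <= alpha by rewrite (le_trans r0)// ltW.
have [x xP] : exists x, forall v, dot v v = 1 ->
    alpha * m%:R * enorm (col_mx x (1%:M : 'M_1))
      <= - dot (L (vvT v)) (A0 *m x + b0).
  apply: (sdp_center hLtr f0 _ x0K _ f_inf) => [|z s t l L1 tP].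
    rewrite mulr_ge0//= -ltr_pdivlMr// mulrC /alpha; lra.
  by apply: f_lb; exists z, s, l, L1.
have := adm_le alpha a_ge0 (admissible_center hLbij hLtr a_ge0 xP).
by rewrite lee_fin leNgt a_gt.
Qed.
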